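(* Let $\widetilde{\mathfrak F}$ be a class of fuzzy sets in the universe $\mathcal U$. Let $M$ be a set of functions $\mathcal U\to[0,1]$ such that $\mu_A\in M$ for any $A\in\widetilde{\mathfrak F}$, and let $\star$ be a product over $M$, meaning that $\star$ is a binary operation over $M$ such that $(M,+,\star)$ is a ring, where $+$ is the standard sum. For $A$ and $B$ in $\widetilde{\mathfrak F}$ let $A\Cup B$ and $A\Cap B$ be the fuzzy sets in $\mathcal U$ with membership functions $$\mu_{A\Cup B}:=\mu_A+\mu_B-\mu_A\star\mu_B,\qquad \mu_{A\Cap B}:=\mu_A\star\mu_B .$$ Let $\mathfrak F$ be the subclass of elements of $\widetilde{\mathfrak F}$ whose membership functions are idempotent with respect to $\star$ (i.e. $\mu_A\star\mu_A=\mu_A$). If the following facts hold: i) $\emptyset\in\mathfrak F$; ii) $A\in\mathfrak F\Rightarrow\neg A\in\mathfrak F$; iii) $\mu_A+\mu_B\le 1$ if and only if $A\Cap B=\emptyset$; iv) if $\{A_i\}_{i\in\mathbb N}\subset\mathfrak F$ satisfies $A_i\Cap A_j=\emptyset$ for $i\neq j$, then $\Cup_i A_i\in\mathfrak F$; then: 1) $\mathfrak F$ is a quantum logic with respect to the fuzzy order relation (fuzzy inclusion), where the orthocomplementation is given by the fuzzy complement; 2) $A\perp B$ if and only if $\mu_A\star\mu_B=0$; 3) if $\mathfrak F_0\subset\mathfrak F$ is a lattice such that $A\vee B=A\Cup B$ and $A\wedge B=A\Cap B$ for all $A,B\in\mathfrak F_0$, then all the fuzzy sets of $\mathfrak F_0$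 are pairwise compatible and their membership functions commute with respect to $\star$.
   Context: **Fuzzy sets.** The universe $\mathcal U$ is a non-empty set. A fuzzy set $A$ in $\mathcal U$ is a pair $(\mathcal U,\mu_A)$ with membership function $\mu_A:\mathcal U\to[0,1]$. Fuzzy inclusion: $A\subseteq B$ if $\mu_A(x)\le\mu_B(x)$ for any $x\in\mathcal U$. Fuzzy complement: $\mu_{\neg A}=1-\mu_A$. The empty set $\emptyset$ is the fuzzy set with zero membership function. **The product.** The product $\star$ is unital and associative, and in general non-commutative; it replaces the pointwise product in the usual product t-norm union and intersection of fuzzy sets. In iv), $\Cup_iA_i$ is the countable version of the operation $\Cup$; since $\mu_{A_i}\star\mu_{A_j}=0$ for $i\ne j$, its membership function is $\sum_i\mu_{A_i}$. **Posets.** Let $(L,\ge)$ be a poset; $\wedge,\vee$ denote greatest lower bound and least upper bound. $L$ is bounded if it contains a minimum $0$ and a maximum $\mathbb I$. It is orthocomplemented if it is equipped with a map $\neg:L\to L$ (the orthocomplementation) such that $\neg(\neg p)=p$; $p\ge q\Rightarrow\neg q\ge\neg p$; and $p\wedge\neg p$, $p\vee\neg p$ exist with $p\wedge\neg p=0$, $p\vee\neg p=\mathbb I$. Elements $p,q$ are orthogonal, $p\perp q$, if $\neg p\ge q$. $L$ is $\sigma$-orthocomplete if every countable set $\{p_i\}_{i\in\mathbb N}$ with $p_i\perp p_j$ for $i\ne j$ admits a least upper bound in $L$. $L$ is orthomodular if it is orthocomplemented and $q\ge p$ implies $q=p\vee(\neg p\wedge q)$. Elements $p,q\in L$ are compatible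 if $p=r_1\vee r_3$ and $q=r_2\vee r_3$ with $r_i\perp r_j$ for $i\ne j$. A lattice is a poset in which any two elements have a greatest lower bound and a least upper bound. **Quantum logic.** A generalized probability measure on a bounded $\sigma$-orthocomplete orthomodular poset $L$ is a map $\sigma:L\to[0,1]$ with $\sigma(\mathbb I)=1$ and $\sigma(\vee_{i\in\mathbb N}p_i)=\sum_{i\in\mathbb N}\sigma(p_i)$ for any countable set of pairwise orthogonal elements. A set $\mathcal S$ of generalized probability measures on $L$ is an ordering set if $\sigma(p)\ge\sigma(q)$ for any $\sigma\in\mathcal S$ implies $p\ge q$. A quantum logic is a bounded $\sigma$-orthocomplete orthomodular poset equipped with an ordering set of generalized probability measures.
   Formalization: M is taken as a set of real-valued functions on U instead of [0,1]-valued ones (fuzzy sets remain [0,1]-valued), since a ring of [0,1]-valued functions under the standard sum is {0}, contradicting that the membership function 1 of the complement of the empty set lies in M. *)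

(* Defs.v *)
From HB Require Import structures.
From mathcomp Require Import all_boot all_order all_algebra.
From mathcomp Require Import all_classical all_reals all_analysis.

Set Implicit Arguments.
Unset Strict Implicit.
Unset Printing Implicit Defensive.

Import Order.TTheory GRing.Theory Num.Theory.

Local Open Scope classical_set_scope.
Local Open Scope ring_scope.

(** ** Posets and quantum logics

   Suprema and infima in a bare poset need not exist, so joins, meets, minimum
   and maximum are relations; an equation such as [q = p \/ r] then asserts
   that the least upper bound exists and equals [q]. *)

HB.instance Definition _ (d : Order.disp_t) (T : porderType d) (P : pred T) :=
  [SubChoice_isSubPOrder of {x : T | P x} by <: with d].

Definition is_join (d : Order.disp_t) (L : porderType d) (p q r : L) : Prop :=
  supremums [set p; q] r.

Definition is_meet (d : Order.disp_t) (L : porderType d) (p q r : L) : Prop :=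
  infimums [set p; q] r.

Definition is_lattice (d : Order.disp_t) (L : porderType d) : Prop :=
  forall p q : L, (exists r, is_meet p q r) /\ (exists r, is_join p q r).

Definition is_bounded (d : Order.disp_t) (L : porderType d) (O I : L) : Prop :=
  forall p : L, (O <= p <= I)%O.

Record is_orthocomplementation (d : Order.disp_t) (L : porderType d)
    (O I : L) (neg : L -> L) : Prop := IsOrthocomplementation {
  ortho_negK : forall p, neg (neg p) = p ;
  ortho_anti : forall p q, (q <= p)%O -> (neg p <= neg q)%O ;
  ortho_meet : forall p, is_meet p (neg p) O ;
  ortho_join : forall p, is_join p (neg p) I }.

Definition perp (d : Order.disp_t) (L : porderType d) (neg : L -> L)
  (p q : L) : Prop := (q <= neg p)%O.

Definition pairwise_perp (d : Order.disp_t) (L : porderType d)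
  (neg : L -> L) (p : nat -> L) : Prop :=
  forall i j, i <> j -> perp neg (p i) (p j).

Definition sigma_orthocomplete (d : Order.disp_t) (L : porderType d)
  (neg : L -> L) : Prop :=
  forall p : nat -> L, pairwise_perp neg p ->
    exists s, supremums (range p) s.

Definition orthomodular_law (d : Order.disp_t) (L : porderType d)
  (neg : L -> L) : Prop :=
  forall p q : L, (p <= q)%O ->
    exists r, is_meet (neg p) q r /\ is_join p r q.

(* Orthogonality is symmetric for an orthocomplementation, so one ordering of
   each pair of indices is enough. *)
Definition compatible (d : Order.disp_t) (L : porderType d) (neg : L -> L)
  (p q : L) : Prop :=
  exists r1 r2 r3 : L,
    [/\ perp neg r1 r2, perp neg r1 r3 & perp neg r2 r3] /\
    (is_join r1 r3 p /\ is_join r2 r3 q).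

Record generalized_probability (R : realType) (d : Order.disp_t)
    (L : porderType d) (I : L) (neg : L -> L) (sigma : L -> R) : Prop :=
  GeneralizedProbability {
  gprob_itv : forall p, 0 <= sigma p <= 1 ;
  gprob_top : sigma I = 1 ;
  gprob_sigma_additive : forall (p : nat -> L) (s : L),
    pairwise_perp neg p -> supremums (range p) s ->
    (\sum_(0 <= i <oo) (sigma (p i))%:E = (sigma s)%:E)%E }.

Definition ordering_set (R : realType) (d : Order.disp_t) (L : porderType d)
  (I : L) (neg : L -> L) (S : set (L -> R)) : Prop :=
  (forall sigma, S sigma -> generalized_probability I neg sigma) /\
  (forall p q : L, (forall sigma, S sigma -> sigma q <= sigma p) -> (q <= p)%O).

Definition is_quantum_logic (R : realType) (d : Order.disp_t)
  (L : porderType d) (neg : L -> L) : Prop :=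
  exists O I : L,
    [/\ is_bounded O I, is_orthocomplementation O I neg,
        sigma_orthocomplete neg, orthomodular_law neg &
        exists S : set (L -> R), ordering_set I neg S].

(** ** Fuzzy sets *)

Record fuzzy (R : realType) (U : Type) := Fuzzy {
  mu : U -> R ;
  mu_itv : forall x, 0 <= mu x <= 1 }.

Lemma fuzzy_ext (R : realType) (U : Type) (A B : fuzzy R U) :
  (forall x, mu A x = mu B x) -> A = B.
Proof.
case: A B => [f hf] [g hg] /= /funext fg.
rewrite fg in hf *; congr Fuzzy; exact: Prop_irrelevance.
Qed.

HB.instance Definition _ (R : realType) (U : Type) :=
  gen_eqMixin (fuzzy R U).
HB.instance Definition _ (R : realType) (U : Type) :=
  gen_choiceMixin (fuzzy R U).

Definition fuzzy_le (R : realType) (U : Type) (A B : fuzzy R U) : bool :=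
  `[< forall x, mu A x <= mu B x >].

Lemma fuzzy_le_refl (R : realType) (U : Type) :
  reflexive (@fuzzy_le R U).
Proof. by move=> A; apply/asboolP => x. Qed.

Lemma fuzzy_le_anti (R : realType) (U : Type) :
  antisymmetric (@fuzzy_le R U).
Proof.
move=> A B /andP[/asboolP AB /asboolP BA]; apply: fuzzy_ext => x.
by apply/le_anti; rewrite AB BA.
Qed.

Lemma fuzzy_le_trans (R : realType) (U : Type) :
  transitive (@fuzzy_le R U).
Proof.
move=> B A C /asboolP AB /asboolP BC; apply/asboolP => x.
exact: le_trans (AB x) (BC x).
Qed.

Fact fuzzy_display : Order.disp_t. Proof. exact: Order.Disp tt tt. Qed.

HB.instance Definition _ (R : realType) (U : Type) :=
  Order.Le_isPOrder.Build fuzzy_display (fuzzy R U)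
    (@fuzzy_le_refl R U) (@fuzzy_le_anti R U) (@fuzzy_le_trans R U).

Lemma fuzzy_leP (R : realType) (U : Type) (A B : fuzzy R U) :
  reflect (forall x, mu A x <= mu B x) (A <= B)%O.
Proof. exact: asboolP. Qed.

Lemma fuzzy_sub_leP (R : realType) (U : Type) (F : set (fuzzy R U)) (A B : F) :
  reflect (forall x, mu (val A) x <= mu (val B) x) (A <= B)%O.
Proof. exact: asboolP. Qed.

Lemma fuzzy_empty_itv (R : realType) (U : Type) (x : U) :
  0 <= (fun _ : U => 0 : R) x <= 1.
Proof. by rewrite lexx ler01. Qed.

Definition fuzzy_empty (R : realType) (U : Type) : fuzzy R U :=
  Fuzzy (@fuzzy_empty_itv R U).

Lemma fuzzy_compl_itv (R : realType) (U : Type) (A : fuzzy R U) (x : U) :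
  0 <= (fun y => 1 - mu A y) x <= 1.
Proof.
by have /andP[A0 A1] := mu_itv A x; rewrite subr_ge0 A1 gerBl A0.
Qed.

Definition fuzzy_compl (R : realType) (U : Type) (A : fuzzy R U) : fuzzy R U :=
  Fuzzy (@fuzzy_compl_itv R U A).

Lemma compl_on_subproof (R : realType) (U : Type) (F : set (fuzzy R U))
  (hF : forall A, F A -> F (fuzzy_compl A)) (A : F) :
  fuzzy_compl (val A) \in F.
Proof. exact/mem_set/hF/set_mem/(valP A). Qed.

Definition compl_on (R : realType) (U : Type) (F : set (fuzzy R U))
  (hF : forall A, F A -> F (fuzzy_compl A)) (A : F) : F :=
  exist _ (fuzzy_compl (val A)) (compl_on_subproof hF A).

(** ** Products of membership functions *)

(* [(M, +, star)] is a unital associative ring, [+] being the pointwise sum and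
   [star] mattering only on [M].  Elements of [M] are real-valued: a set of
   [0,1]-valued functions closed under sums and opposites is trivial, so it
   could not contain the membership function 1.  The unit of [star] is not
   required to be the constant function 1. *)
Record is_function_ring (R : realType) (U : Type) (M : set (U -> R))
    (star : (U -> R) -> (U -> R) -> (U -> R)) : Prop := IsFunctionRing {
  fring0 : M (fun _ => 0) ;
  fringD : forall f g, M f -> M g -> M (fun x => f x + g x) ;
  fringN : forall f, M f -> M (fun x => - f x) ;
  fringM : forall f g, M f -> M g -> M (star f g) ;
  fringA : forall f g h, M f -> M g -> M h ->
    star f (star g h) = star (star f g) h ;
  fring1 : exists2 e, M e & forall f, M f -> star e f = f /\ star f e = f ;
  fringDl : forall f g h, M f -> M g -> M h ->
    star (fun x => f x + g x) h = (fun x => star f h x + star g h x) ;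
  fringDr : forall f g h, M f -> M g -> M h ->
    star h (fun x => f x + g x) = (fun x => star h f x + star h g x) }.

(* [A ⋒ B = C] and [A ⋓ B = C], as relations since [star] need not return a
   [0,1]-valued function. *)
Definition is_Cap (R : realType) (U : Type)
  (star : (U -> R) -> (U -> R) -> (U -> R)) (A B C : fuzzy R U) : Prop :=
  mu C = star (mu A) (mu B).

Definition is_Cup (R : realType) (U : Type)
  (star : (U -> R) -> (U -> R) -> (U -> R)) (A B C : fuzzy R U) : Prop :=
  mu C = (fun x => mu A x + mu B x - star (mu A) (mu B) x).

(* Countable [⋓] of a sequence whose members have pairwise empty [⋒]: the
   product terms vanish and a pointwise series of membership values remains. *)
Definition is_bigCup (R : realType) (U : Type) (A : nat -> fuzzy R U)
  (C : fuzzy R U) : Prop :=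
  forall x, (\sum_(0 <= i <oo) (mu (A i) x)%:E = (mu C x)%:E)%E.

Definition idempotents (R : realType) (U : Type)
  (star : (U -> R) -> (U -> R) -> (U -> R)) (Ft : set (fuzzy R U)) :
  set (fuzzy R U) :=
  [set A | Ft A /\ star (mu A) (mu A) = mu A].

(* Main.v *)
Require Import Defs.
From HB Require Import structures.
From mathcomp Require Import all_boot all_order all_algebra.
From mathcomp Require Import all_classical all_reals all_analysis.
From mathcomp Require Import lra.

Set Implicit Arguments.
Unset Strict Implicit.
Unset Printing Implicit Defensive.

Import Order.TTheory GRing.Theory Num.Theory.

Local Open Scope classical_set_scope.
Local Open Scope ring_scope.

(* By (iii), the fuzzy sets A and B of F are orthogonal iff
   mu A + mu B <= 1 iff mu A ⋆ mu B = 0, so (iv) says that F is closed under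
   pointwise sums of pairwise orthogonal sequences.  Such a sum C is the
   supremum of the sequence: if D in F bounds every A i, then adding the
   complement of D in front of the sequence keeps it pairwise orthogonal, and
   its sum 1 - mu D + mu C is at most 1.  The quantum logic axioms follow from
   this without further use of ⋆; for instance, if T lies below A and below its
   complement, then T is orthogonal to itself, the sum of T and T is their
   supremum, and 2 T <= T gives T = 0.  Evaluations at the points of the
   universe form the ordering set.  For compatibility of A and B in the lattice
   F0, take r3 = A ⋒ B and r1, r2 the differences A - r3, B - r3, which are
   orthogonal because mu A + mu B - mu r3 is the membership function of A ⋓ B. *)

Definition orthosum_closed (R : realType) (U : Type) (F : set (fuzzy R U))
    (hF : forall A, F A -> F (fuzzy_compl A)) : Prop :=
  forall A : nat -> F, pairwise_perp (compl_on hF) A ->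
    exists C : F, is_bigCup (fun i => val (A i)) (val C).

Lemma mu_ge0 (R : realType) (U : Type) (A : fuzzy R U) x : 0 <= mu A x.
Proof. by have /andP[] := mu_itv A x. Qed.

Lemma mu_le1 (R : realType) (U : Type) (A : fuzzy R U) x : mu A x <= 1.
Proof. by have /andP[] := mu_itv A x. Qed.

Lemma is_joinP (d : Order.disp_t) (L : porderType d) (p q r : L) :
  is_join p q r <->
  [/\ (p <= r)%O, (q <= r)%O &
      forall s, (p <= s)%O -> (q <= s)%O -> (r <= s)%O].
Proof.
split=> [[rub rlub]|[pr qr rlub]].
- split; [by apply: rub; left|by apply: rub; right|] => s ps qs.
  by apply: rlub => _ [->|->].
- split=> [_ [->|->] //|s sub].
  by apply: rlub; apply: sub; [left|right].
Qed.

Lemma is_meetP (d : Order.disp_t) (L : porderType d) (p q r : L) :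
  is_meet p q r <->
  [/\ (r <= p)%O, (r <= q)%O &
      forall s, (s <= p)%O -> (s <= q)%O -> (s <= r)%O].
Proof.
split=> [[rlb rglb]|[pr qr rglb]].
- split; [by apply: rlb; left|by apply: rlb; right|] => s ps qs.
  by apply: rglb => _ [->|->].
- split=> [_ [->|->] //|s slb].
  by apply: rglb; apply: slb; [left|right].
Qed.

Lemma is_joinC (d : Order.disp_t) (L : porderType d) (p q r : L) :
  is_join p q r -> is_join q p r.
Proof. by rewrite /is_join setUC. Qed.

Lemma is_meetC (d : Order.disp_t) (L : porderType d) (p q r : L) :
  is_meet p q r -> is_meet q p r.
Proof. by rewrite /is_meet setUC. Qed.

Lemma perpP (R : realType) (U : Type) (F : set (fuzzy R U))
    (hF : forall A, F A -> F (fuzzy_compl A)) (A B : F) :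
  perp (compl_on hF) A B <-> forall x, mu (val A) x + mu (val B) x <= 1.
Proof.
split=> [/fuzzy_sub_leP AB x|AB]; last apply/fuzzy_sub_leP => x.
- by have := AB x; rewrite /= lerBrDl.
- by rewrite /= lerBrDl.
Qed.

Lemma bigCup_ub (R : realType) (U : Type) (A : nat -> fuzzy R U)
    (C : fuzzy R U) i x :
  is_bigCup A C -> mu (A i) x <= mu C x.
Proof.
move=> /(_ x) sumC; rewrite -lee_fin -sumC.
have A0 n : (0 <= n)%N -> true -> (0 <= (mu (A n) x)%:E :> \bar R)%E.
  by rewrite lee_fin mu_ge0.
(* The bound [i.+1] makes the term of index [i] the last summand of the partial sum. *)
apply: le_trans (nneseries_lim_ge i.+1 A0).
rewrite big_nat_recr //= leeDr //.
by apply: sume_ge0 => j _; exact: A0.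
Qed.

Lemma bigCup_sup (R : realType) (U : Type) (F : set (fuzzy R U))
    (hF : forall A, F A -> F (fuzzy_compl A)) (A : nat -> F) (C : F) :
  orthosum_closed hF -> pairwise_perp (compl_on hF) A ->
  is_bigCup (fun i => val (A i)) (val C) -> supremums (range A) C.
Proof.
move=> Fsum Aperp sumC; split.
  by move=> _ [i _ <-]; apply/fuzzy_sub_leP => x; exact: bigCup_ub sumC.
move=> D Dub.
have AD i x : mu (val (A i)) x <= mu (val D) x.
  by move: x; apply/fuzzy_sub_leP; apply: Dub; exists i.
pose B i := if i is j.+1 then A j else compl_on hF D.
have Bperp : pairwise_perp (compl_on hF) B.
  move=> [|i] [|j] // ij; apply/perpP => x /=.
  - by have := AD j x; lra.
  - by have := AD i x; lra.
  - by move: x; apply/perpP; apply: Aperp => /(congr1 succn).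
have [E BE] := Fsum _ Bperp.
apply/fuzzy_sub_leP => x.
have := BE x.
(* Splitting off the head of [B] and shifting the index turns the sum [E] into [1 - mu D + mu C] at
   [x]. *)
rewrite nneseries_recl //; last by move=> k _; rewrite lee_fin mu_ge0.
rewrite -(@nneseries_addn _ _ 1); last by move=> k; rewrite lee_fin mu_ge0.
under eq_eseriesr do rewrite addn1 /=.
rewrite sumC -EFinD => -[EDC].
by have := mu_le1 (val E) x; rewrite -EDC; lra.
Qed.

(** The finite case is obtained from the countable one by padding [A], [B] with empty sets, which
    are orthogonal to everything, themselves included. *)
Lemma perp_join_add (R : realType) (U : Type) (F : set (fuzzy R U))
    (hF : forall A, F A -> F (fuzzy_compl A)) (A B : F) :
  F (fuzzy_empty R U) -> orthosum_closed hF -> perp (compl_on hF) A B ->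
  exists2 C : F, is_join A B C &
    forall x, mu (val C) x = mu (val A) x + mu (val B) x.
Proof.
move=> F0 Fsum /perpP AB.
pose O : F := exist _ (fuzzy_empty R U) (mem_set F0).
pose P i := if i is j.+1 then if j is _.+1 then O else B else A.
have Pperp : pairwise_perp (compl_on hF) P.
  move=> i j ij; apply/perpP => x; have := AB x.
  have := mu_le1 (val A) x; have := mu_le1 (val B) x.
  by case: i j ij => [|[|i]] [|[|j]] //= _; lra.
have [C PC] := Fsum _ Pperp.
have [_ Club] := bigCup_sup Fsum Pperp PC.
exists C.
  apply/is_joinP; split.
  - by apply/fuzzy_sub_leP => x; exact: (bigCup_ub 0 _ PC).
  - by apply/fuzzy_sub_leP => x; exact: (bigCup_ub 1 _ PC).
  - move=> D AD BD; apply: Club => _ [[|[|i]] _ <-] //.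
    by apply/fuzzy_sub_leP => x; exact: mu_ge0.
(* From index 2 on, every term of [P] is zero. *)
move=> x; have := PC x; rewrite (@nneseries_split _ _ 0 2); last first.
  by move=> k _; rewrite lee_fin mu_ge0.
rewrite eseries0; last by move=> [|[|i]].
by rewrite big_nat_recl // big_nat1 adde0 -EFinD => -[<-].
Qed.

Lemma compl_onK (R : realType) (U : Type) (F : set (fuzzy R U))
    (hF : forall A, F A -> F (fuzzy_compl A)) (A : F) :
  compl_on hF (compl_on hF A) = A.
Proof. by apply/val_inj/fuzzy_ext => x /=; rewrite subKr. Qed.

Lemma compl_on_anti (R : realType) (U : Type) (F : set (fuzzy R U))
    (hF : forall A, F A -> F (fuzzy_compl A)) (A B : F) :
  (A <= B)%O -> (compl_on hF B <= compl_on hF A)%O.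
Proof.
by move=> /fuzzy_sub_leP AB; apply/fuzzy_sub_leP => x; rewrite /= lerB.
Qed.

(** This yields the orthomodular law. Since [A] lies below [B], it is orthogonal to the complement
    of [B]; the complement of their sum [D] is the difference of [B] and [A], and by De Morgan it is
    the required meet. *)
Lemma diff_meet_join (R : realType) (U : Type) (F : set (fuzzy R U))
    (hF : forall A, F A -> F (fuzzy_compl A)) (A B : F) :
  F (fuzzy_empty R U) -> orthosum_closed hF -> (A <= B)%O ->
  exists C : F, [/\ is_meet (compl_on hF A) B C, is_join A C B &
    forall x, mu (val C) x = mu (val B) x - mu (val A) x].
Proof.
move=> F0 Fsum /fuzzy_sub_leP AB.
have [|D /is_joinP[AD BD Dlub] DE] :=
  @perp_join_add _ _ _ hF A (compl_on hF B) F0 Fsum.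
  by apply/perpP => x /=; have := AB x; lra.
have CE x : mu (val (compl_on hF D)) x = mu (val B) x - mu (val A) x.
  by rewrite /= DE /=; lra.
exists (compl_on hF D); split=> //.
- apply/is_meetP; split.
  + exact: compl_on_anti.
  + by rewrite -[leRHS](compl_onK hF); exact: compl_on_anti.
  + move=> T TA TB; rewrite -(compl_onK hF T); apply: compl_on_anti.
    by apply: Dlub; [rewrite -(compl_onK hF A)|]; exact: compl_on_anti.
(* Adding the difference back to [A] gives a join [E] with the membership function of [B]. *)
- have [|E jE EE] := @perp_join_add _ _ _ hF A (compl_on hF D) F0 Fsum.
    by apply/perpP => x; rewrite CE; have := mu_le1 (val B) x; lra.
  suff <- : E = B by [].
  by apply/val_inj/fuzzy_ext => x; rewrite EE CE; lra.
Qed.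

Lemma perp_self_eq0 (R : realType) (U : Type) (F : set (fuzzy R U))
    (hF : forall A, F A -> F (fuzzy_compl A)) (A : F) :
  F (fuzzy_empty R U) -> orthosum_closed hF -> perp (compl_on hF) A A ->
  forall x, mu (val A) x = 0.
Proof.
move=> F0 Fsum AA x.
have [C /is_joinP[_ _ Club] CE] := perp_join_add F0 Fsum AA.
have /fuzzy_sub_leP/(_ x) := Club _ (lexx A) (lexx A).
by rewrite CE; have := mu_ge0 (val A) x; lra.
Qed.

Lemma orthosum_closed_quantum_logic (R : realType) (U : Type)
    (F : set (fuzzy R U)) (hF : forall A, F A -> F (fuzzy_compl A)) :
  F (fuzzy_empty R U) -> orthosum_closed hF -> is_quantum_logic R (compl_on hF).
Proof.
move=> F0 Fsum.
pose O : F := exist _ (fuzzy_empty R U) (mem_set F0).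
have Ole (A : F) : (O <= A)%O by apply/fuzzy_sub_leP => x; exact: mu_ge0.
have meetO (A : F) : is_meet A (compl_on hF A) O.
  apply/is_meetP; split => // T /fuzzy_sub_leP TA /fuzzy_sub_leP TnA.
  have TT : perp (compl_on hF) T T.
    by apply/perpP => x; have := TA x; have := TnA x => /=; lra.
  by apply/fuzzy_sub_leP => x; rewrite (perp_self_eq0 F0 Fsum TT).
have leI (A : F) : (A <= compl_on hF O)%O.
  by apply/fuzzy_sub_leP => x; rewrite /= subr0 mu_le1.
exists O, (compl_on hF O); split.
- by move=> A; rewrite Ole leI.
- split=> //; [exact: compl_onK|by move=> A B; exact: compl_on_anti|] => A.
  (* De Morgan dual of [meetO]: the complement of an upper bound [T] lies below both [A] and its
     complement, hence below [O]. *)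
  apply/is_joinP; split=> // T AT nAT; rewrite -(compl_onK hF T).
  apply: compl_on_anti; have /is_meetP[_ _ glb] := meetO A.
  apply: glb; last exact: compl_on_anti.
  by rewrite -[leRHS](compl_onK hF); exact: compl_on_anti.
- move=> A Aperp; have [C sumC] := Fsum _ Aperp.
  by exists C; exact: bigCup_sup sumC.
- by move=> A B /(diff_meet_join F0 Fsum)[C [mC jC _]]; exists C.
exists [set sigma | exists x, sigma = fun A : F => mu (val A) x].
split=> [_ [x ->]|A B AB]; last first.
  by apply/fuzzy_sub_leP => x; apply: (AB (fun A : F => mu (val A) x)); exists x.
split=> [A||A S Aperp Ssup].
- exact: mu_itv.
- by rewrite /= subr0.
(* Suprema are unique, so [S] is the pointwise sum [C], and evaluation at a point is
   sigma-additive. *)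
have [C sumC] := Fsum _ Aperp.
by rewrite (is_subset1_supremums Ssup (bigCup_sup Fsum Aperp sumC)) sumC.
Qed.

Lemma compatible_of_add_sub (R : realType) (U : Type) (F : set (fuzzy R U))
    (hF : forall A, F A -> F (fuzzy_compl A)) (A B C D : F) :
  F (fuzzy_empty R U) -> orthosum_closed hF -> (C <= A)%O -> (C <= B)%O ->
  (forall x, mu (val D) x = mu (val A) x + mu (val B) x - mu (val C) x) ->
  compatible (compl_on hF) A B.
Proof.
move=> F0 Fsum CA CB DE.
have [P [_ jA PE]] := diff_meet_join F0 Fsum CA.
have [Q [_ jB QE]] := diff_meet_join F0 Fsum CB.
exists P, Q, C; split; last by split; exact: is_joinC.
split; apply/perpP => x; rewrite ?PE ?QE.
(* The two differences add up to [mu D - mu C], which is at most 1. *)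
- by have := mu_le1 (val D) x; have := mu_ge0 (val C) x; rewrite DE; lra.
- by rewrite subrK mu_le1.
- by rewrite subrK mu_le1.
Qed.

Theorem theorem7 (R : realType) (U : Type) (U_nonempty : inhabited U)
  (Ft : set (fuzzy R U)) (M : set (U -> R))
  (star : (U -> R) -> (U -> R) -> (U -> R))
  (Ft_sub_M : forall A : fuzzy R U, Ft A -> M (mu A))
  (star_ring : is_function_ring M star)
  (F : set (fuzzy R U)) (F_def : F = idempotents star Ft)
  (hi : F (fuzzy_empty R U))
  (hii : forall A : fuzzy R U, F A -> F (fuzzy_compl A))
  (hiii : forall A B : fuzzy R U, F A -> F B ->
     ((forall x, mu A x + mu B x <= 1) <-> is_Cap star A B (fuzzy_empty R U)))
  (hiv : forall A : nat -> fuzzy R U, (forall i, F (A i)) ->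
     (forall i j, i <> j -> is_Cap star (A i) (A j) (fuzzy_empty R U)) ->
     exists2 C, F C & is_bigCup A C) :
  [/\ is_quantum_logic R (compl_on hii),
      (forall A B : F, perp (compl_on hii) A B <->
         star (mu (val A)) (mu (val B)) = (fun _ => 0)) &
      (forall F0 : set F,
         is_lattice F0 ->
         (forall A B C : F0, is_join A B C ->
            is_Cup star (val (val A)) (val (val B)) (val (val C))) ->
         (forall A B C : F0, is_meet A B C ->
            is_Cap star (val (val A)) (val (val B)) (val (val C))) ->
         forall A B : F0,
           compatible (compl_on hii) (val A) (val B) /\
           star (mu (val (val A))) (mu (val (val B))) =
           star (mu (val (val B))) (mu (val (val A))))].
Proof.
have perp_star (A B : F) : perp (compl_on hii) A B <->
    is_Cap star (val A) (val B) (fuzzy_empty R U).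
  have FA := set_mem (valP A); have FB := set_mem (valP B).
  by split=> [/perpP|/hiii-/(_ FA FB) AB]; [move/hiii; apply|apply/perpP].
have Fsum : orthosum_closed hii.
  move=> A Aperp.
  have [|i j ij|C FC sumC] := @hiv (fun i => val (A i)).
  - by move=> i; exact: set_mem (valP (A i)).
  - by apply/perp_star/Aperp.
  - by exists (exist _ C (mem_set FC)).
split.
- exact: orthosum_closed_quantum_logic.
- by move=> A B; split=> [/perp_star|AB] //; apply/perp_star.
move=> F0 latF0 CupF0 CapF0 A B.
have [[C mC] [D jD]] := latF0 A B.
have CE := CapF0 _ _ _ mC; have DE := CupF0 _ _ _ jD.
(* The meet is symmetric, so both products are the membership function of the same [C]. *)
split; last by rewrite -CE; exact: CapF0 (is_meetC mC).
have /is_meetP[CA CB _] := mC.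
(* [C] and [D] are the meet and join inside [F0]; the order and the formula for [mu D] carry over to
   [F]. *)
apply: (@compatible_of_add_sub _ _ _ _ _ _ (val C) (val D)) => // x.
by rewrite DE CE.
Qed.
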